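(* Let $\{A,B,C\}\subset S^{1,1}$ be a non-degenerate spatiolateral de Sitter triangle with side lengths $a,b,c$. If the triangle is non-contractible, then $a+b+c>2\pi$. If the triangle is contractible, then $a+b+c<2\pi$.
   Context: On $\mathbb{R}^3$ let $\langle\langle x,y\rangle\rangle=-x_1y_1+x_2y_2+x_3y_3$. $S^{1,1}=\{x:\langle\langle x,x\rangle\rangle=1\}$. A two-dimensional linear subspace is spacelike if $\langle\langle\cdot,\cdot\rangle\rangle$ restricted to it is positive definite. For $A,B\in S^{1,1}$ with $A\ne\pm B$, the side between $A$ and $B$ is spacelike if $\operatorname{span}(A,B)$ is spacelike (equivalently $|\langle\langle A,B\rangle\rangle|<1$); its length is then $\arccos(\langle\langle A,B\rangle\rangle)\in(0,\pi)$. A spatiolateral triangle is a set of three distinct points $\{A,B,C\}\subset S^{1,1}$ all of whose sides are spacelike; it is non-degenerate if $A,B,C$ are linearly independent. It is contractible if, after projecting the vertices to the $(x_2,x_3)$-plane, there is a line through the origin such that all three projected points lie on one side of the line; otherwise it is non-contractible. Side lengths: $a$ between $B$ and $C$, $b$ between $A$ and $C$, $c$ between $A$ and $B$. *)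

(* Defs.v *)
From mathcomp Require Import all_boot all_order all_algebra.
From mathcomp Require Import reals trigo.
Set Implicit Arguments.
Unset Strict Implicit.
Unset Printing Implicit Defensive.
Import Order.TTheory GRing.Theory Num.Theory.
Local Open Scope ring_scope.

(* Coordinates are indexed from 0: x 0 0 is the timelike coordinate x_1, and
   x 0 1, x 0 2 are x_2, x_3. *)
Definition mink (R : realType) (x y : 'rV[R]_3) : R :=
  - (x 0 0 * y 0 0) + x 0 1 * y 0 1 + x 0 2 * y 0 2.

Definition deSitter (R : realType) (x : 'rV[R]_3) : Prop := mink x x = 1.

Definition spacelike (R : realType) (U : {vspace 'rV[R]_3}) : Prop :=
  \dim U = 2%N /\ forall x, x \in U -> x != 0 -> 0 < mink x x.

Definition spacelike_side (R : realType) (A B : 'rV[R]_3) : Prop :=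
  [/\ A != B, A != - B & spacelike <<[:: A; B]>>%VS].

(* The length of the side between A and B; only meaningful when
   spacelike_side A B holds, in which case |mink A B| < 1. *)
Definition side_length (R : realType) (A B : 'rV[R]_3) : R := acos (mink A B).

Definition spatiolateral_triangle (R : realType) (A B C : 'rV[R]_3) : Prop :=
  [/\ deSitter A, deSitter B & deSitter C] /\
  [/\ A != B, B != C & A != C] /\
  [/\ spacelike_side A B, spacelike_side B C & spacelike_side A C].

Definition nondegenerate_triangle (R : realType) (A B C : 'rV[R]_3) : Prop :=
  free [:: A; B; C].

Definition proj23 (R : realType) (x : 'rV[R]_3) : 'rV[R]_2 :=
  \row_(j < 2) x 0 (lift ord0 j).

Definition dot (R : realType) (p q : 'rV[R]_2) : R := \sum_(j < 2) p 0 j * q 0 j.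

(* A line through the origin of the plane is given by a nonzero normal vector
   n, and its two sides are the open half-planes 0 < dot n p and
   0 < dot (- n) p; since n may be replaced by - n, only the first occurs.
   Closed half-planes would give the same notion for spatiolateral triangles:
   projections of two vertices never point in opposite directions. *)
Definition contractible (R : realType) (A B C : 'rV[R]_3) : Prop :=
  exists2 n : 'rV[R]_2, n != 0 &
    [/\ 0 < dot n (proj23 A), 0 < dot n (proj23 B) & 0 < dot n (proj23 C)].

(* Main.v *)
(** Write [x = <B,C>], [y = <A,C>], [z = <A,B>] for the cosines of the sides.
    The minors [alpha = B ^ C], [beta = C ^ A], [gamma = A ^ B] of the projected
    vertices are nonzero, and [alpha A + beta B + gamma C] is vertical, so its
    Lorentz square is nonpositive.  The triangle is non-contractible exactly
    when the three minors have the same sign.  On the other hand the quadratic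
    form [p^2 + q^2 + r^2 + 2pqz + 2pry + 2qrx] is positive at nonnegative
    [p, q, r] with [p > 0] as soon as [y + z >= 0].  Hence
    - if the signs differ, say [beta] is the odd one out, then flipping [B] gives
      [x + z > 0], so that the two sides at [B] already add up to less than [pi];
    - if the signs agree, then all pairwise sums of [x, y, z] are negative, so
      any two sides add up to more than [pi]; the Gram determinant being negative,
      [cos a] lies outside the interval from [cos (b + c)] to [cos (b - c)], and
      [a < |b - c|] is excluded. *)
Require Import Defs.
From mathcomp Require Import all_boot all_order all_algebra.
From mathcomp Require Import reals trigo.
From mathcomp Require Import ring lra.
Import Order.TTheory GRing.Theory Num.Theory.
Local Open Scope ring_scope.

(** * Positivity of the quadratic form *)

Lemma cone_form_gt0 (R : realFieldType) (x y z p q r : R) :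
  -1 <= x -> -1 < y < 1 -> 0 <= y + z -> p != 0 -> 0 <= p * q -> 0 <= p * r ->
  0 < p ^+ 2 + q ^+ 2 + r ^+ 2 + 2 * (p * q * z + p * r * y + q * r * x).
Proof.
move=> x_ge y_itv yz_ge0 p_neq0 pq_ge0 pr_ge0.
have p2_gt0 : 0 < p ^+ 2 by rewrite exprn_even_gt0.
(* Signs enter only through products, so triples of nonnegative and of nonpositive coefficients are
   covered at once. *)
have qr_ge0 : 0 <= q * r.
  rewrite -(pmulr_rge0 _ p2_gt0).
  have -> : p ^+ 2 * (q * r) = (p * q) * (p * r) by ring.
  exact: mulr_ge0.
have h1 : 0 <= p * q * (y + z) by exact: mulr_ge0.
have h2 : 0 <= q * r * (1 + x) by apply: mulr_ge0 => //; lra.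
(* What remains of the form once [2pq(y + z)] and [2qr(1 + x)] are split off; for [q = r] it reduces
   to [p^2]. *)
have h3 : 0 < (p - y * (q - r)) ^+ 2 + (1 - y ^+ 2) * (q - r) ^+ 2.
  have y2 : 0 < 1 - y ^+ 2 by nra.
  have [->|qr] := eqVneq q r; first by rewrite subrr mulr0 subr0 expr0n mulr0 addr0.
  by rewrite ltr_wpDl ?sqr_ge0// mulr_gt0// exprn_even_gt0//= subr_eq0.
have -> : p ^+ 2 + q ^+ 2 + r ^+ 2 + 2 * (p * q * z + p * r * y + q * r * x) =
  (p - y * (q - r)) ^+ 2 + (1 - y ^+ 2) * (q - r) ^+ 2 +
  2 * (p * q * (y + z)) + 2 * (q * r * (1 + x)) by ring.
lra.
Qed.

(** * Sums of angles read off from their cosines *)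

Section AcosSums.
Context {R : realType}.
Implicit Types x y z : R.

Lemma ltr_acos x y : -1 <= x <= 1 -> -1 <= y <= 1 -> x < y -> acos y < acos x.
Proof.
move=> hx hy xy; rewrite -ltr_cos ?in_itv/= ?acos_ge0 ?acos_lepi//.
by rewrite !acosK ?in_itv.
Qed.

Lemma acosD_lt_pi x y : -1 <= x <= 1 -> -1 <= y <= 1 -> 0 < x + y ->
  acos x + acos y < pi.
Proof.
move=> hx hy xy; have := @ltr_acos (- y) x; rewrite acosN//.
by move=> /(_ ltac:(lra) hx ltac:(lra)); lra.
Qed.

Lemma acosD_gt_pi x y : -1 <= x <= 1 -> -1 <= y <= 1 -> x + y < 0 ->
  pi < acos x + acos y.
Proof.
move=> hx hy xy; have := @ltr_acos x (- y); rewrite acosN//.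
by move=> /(_ hx ltac:(lra) ltac:(lra)); lra.
Qed.

Lemma acos3_gt_2pi x y z :
  -1 < x < 1 -> -1 < y < 1 -> -1 < z < 1 ->
  x + y < 0 -> y + z < 0 -> x + z < 0 ->
  1 + 2 * x * y * z - x ^+ 2 - y ^+ 2 - z ^+ 2 < 0 ->
  2 * pi < acos x + acos y + acos z.
Proof.
move=> hx hy hz xy yz xz gram_lt0.
have wd (t : R) : -1 < t < 1 -> -1 <= t <= 1 by move=> ?; lra.
have pos (t : R) : -1 < t < 1 -> 0 < acos t < pi.
  by move=> ?; rewrite acos_gt0 ?acos_ltpi //; lra.
have := acosD_gt_pi _ _ (wd _ hx) (wd _ hy) xy.
have := acosD_gt_pi _ _ (wd _ hx) (wd _ hz) xz.
have := acosD_gt_pi _ _ (wd _ hy) (wd _ hz) yz.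
have := pos _ hx; have := pos _ hy; have := pos _ hz.
have := @acosK R x; have := @acosK R y; have := @acosK R z.
rewrite !in_itv /= => /(_ (wd _ hz)) cz /(_ (wd _ hy)) cy /(_ (wd _ hx)) cx.
move: cx cy cz; set a := acos x; set b := acos y; set c := acos z.
move=> cx cy cz hc hb ha bc ac ab.
have cos_ltr (s t : R) : 0 <= s <= pi -> 0 <= t <= pi -> cos s < cos t -> t < s.
  by move=> hs ht; rewrite ltr_cos.
have cos_bc : cos (pi *+ 2 - b - c) = y * z - sin b * sin c.
  have -> : pi *+ 2 - b - c = - (b + c) + pi *+ 2 by ring.
  by rewrite cosD2pi cosN cosD cy cz.
have cosB_bc : cos (b - c) = y * z + sin b * sin c by rewrite cosB cy cz.
have sin2 : (sin b * sin c) ^+ 2 = (1 - y ^+ 2) * (1 - z ^+ 2).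
  by rewrite exprMn !sin2cos2 cy cz.
have sbc_ge0 : 0 <= sin b * sin c.
  by rewrite mulr_ge0// sin_ge0_pi//; apply/andP; split; lra.
have out : (sin b * sin c) ^+ 2 < (x - y * z) ^+ 2.
  rewrite sin2 -subr_gt0.
  by rewrite [X in 0 < X](_ : _ = -(1 + 2 * x * y * z - x ^+ 2 - y ^+ 2 - z ^+ 2));
    [rewrite oppr_gt0 | ring].
(* Below the interval: [b + c > pi] puts [2 pi - b - c] in the range where cosine decreases, so
   [a > 2 pi - b - c]. *)
have [xlo|xhi] := ltrP x (y * z).
  have := cos_ltr a (pi *+ 2 - b - c) ltac:(lra) ltac:(lra).
  have lo : x < y * z - sin b * sin c by nra.
  by rewrite cx cos_bc => /(_ lo); lra.
(* Above the interval: [a < b - c] would give [a + c < b < pi], against [a + c > pi]; likewise with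
   [b] and [c] exchanged. *)
have hi : y * z + sin b * sin c < x by nra.
case: (lerP c b) => [cb|/ltW cb].
  have := cos_ltr (b - c) a ltac:(lra) ltac:(lra).
  by rewrite cx cosB_bc => /(_ hi); lra.
have := cos_ltr (c - b) a ltac:(lra) ltac:(lra).
by rewrite -cosN opprB cx cosB_bc => /(_ hi); lra.
Qed.

End AcosSums.

(** * Minors and Gram identities of de Sitter triangles *)

Section Triangle.
Context {R : realType}.
Implicit Types A B C x y : 'rV[R]_3.

Definition wedge23 x y : R := x 0 1 * y 0 2 - x 0 2 * y 0 1.

Definition det3 A B C : R :=
  A 0 0 * wedge23 B C + B 0 0 * wedge23 C A + C 0 0 * wedge23 A B.

Lemma minkC x y : mink x y = mink y x.
Proof. by rewrite /mink; ring. Qed.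

Lemma dot_proj23 (n : 'rV[R]_2) x :
  dot n (proj23 x) = n 0 0 * x 0 1 + n 0 1 * x 0 2.
Proof.
rewrite /dot !big_ord_recl big_ord0 addr0 !mxE.
by congr (n _ _ * x _ _ + n _ _ * x _ _); apply: val_inj.
Qed.

(** The component of [B] orthogonal to [A] lies in the spacelike plane and has square
    [1 - mink A B ^+ 2]; it vanishes only for [B = A] or [B = - A]. *)
Lemma spacelike_side_mink A B : deSitter A -> deSitter B ->
  spacelike_side A B -> -1 < mink A B < 1.
Proof.
move=> dA dB [AB ANB [_ pos]].
have hU : B - mink A B *: A \in <<[:: A; B]>>%VS.
  by rewrite memvB// ?memvZ// memv_span// !inE eqxx ?orbT.
have sq : mink (B - mink A B *: A) (B - mink A B *: A) = 1 - mink A B ^+ 2.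
  move: dA dB; rewrite /deSitter; set z := mink A B => dA dB.
  transitivity (mink B B - 2 * z * mink A B + z ^+ 2 * mink A A).
    by rewrite /mink !mxE; ring.
  by rewrite dA dB -/z; ring.
suff : B - mink A B *: A != 0.
  by move=> /(pos _ hU); rewrite sq => h; apply/andP; split; nra.
apply/eqP=> B0; move: sq; rewrite B0.
have -> : mink 0 0 = 0 :> R by rewrite /mink !mxE; ring.
move/esym/eqP; rewrite subr_eq0 eq_sym sqrf_eq1 => /orP[] /eqP z1.
- by move: B0 AB; rewrite z1 scale1r => /eqP; rewrite subr_eq0 eq_sym => ->.
- move: B0 ANB; rewrite z1 scaleN1r opprK addrC => /eqP.
  by rewrite addr_eq0 => ->.
Qed.

(** Lagrange's identity in the plane, where the projection of [A] has squared norm [1 + A 0 0 ^+ 2],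
    followed by completing the square. *)
Lemma wedge23_neq0 A B : deSitter A -> deSitter B -> -1 < mink A B < 1 ->
  wedge23 A B != 0.
Proof.
rewrite /deSitter => dA dB hz.
have : wedge23 A B ^+ 2 = (A 0 0 - mink A B * B 0 0) ^+ 2 +
    (1 - mink A B ^+ 2) * (1 + B 0 0 ^+ 2).
  have eA : A 0 1 ^+ 2 + A 0 2 ^+ 2 = 1 + A 0 0 ^+ 2.
    by rewrite -dA /mink; ring.
  have eB : B 0 1 ^+ 2 + B 0 2 ^+ 2 = 1 + B 0 0 ^+ 2.
    by rewrite -dB /mink; ring.
  transitivity ((A 0 1 ^+ 2 + A 0 2 ^+ 2) * (B 0 1 ^+ 2 + B 0 2 ^+ 2) -
    (mink A B + A 0 0 * B 0 0) ^+ 2); first by rewrite /wedge23 /mink; ring.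
  by rewrite eA eB; ring.
move=> w2; rewrite -sqrf_eq0 w2 gt_eqF//.
by rewrite ltr_wpDl ?sqr_ge0// mulr_gt0//; nra.
Qed.

Lemma wedge23_relation A B C i :
  (wedge23 B C *: A + wedge23 C A *: B + wedge23 A B *: C) 0 i =
  if i == 0 then det3 A B C else 0.
Proof.
rewrite !mxE; case: i => -[|[|[|//]]] i /=.
- by rewrite (_ : Ordinal i = 0) ?eqxx /det3; [ring|apply: val_inj].
- by rewrite (_ : Ordinal i = 1) /wedge23; [ring|apply: val_inj].
- by rewrite (_ : Ordinal i = 2) /wedge23; [ring|apply: val_inj].
Qed.

(** Both sides are the Lorentz square of the vertical vector in [wedge23_relation]. *)
Lemma wedge23_form A B C : deSitter A -> deSitter B -> deSitter C ->
  wedge23 B C ^+ 2 + wedge23 C A ^+ 2 + wedge23 A B ^+ 2 +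
  2 * (wedge23 B C * wedge23 C A * mink A B + wedge23 B C * wedge23 A B * mink A C
       + wedge23 C A * wedge23 A B * mink B C) = - det3 A B C ^+ 2.
Proof.
rewrite /deSitter => dA dB dC.
rewrite -[wedge23 B C ^+ 2]mulr1 -[X in _ * X + _ + _ + _]dA.
rewrite -[wedge23 C A ^+ 2]mulr1 -[X in _ + _ * X + _ + _]dB.
rewrite -[wedge23 A B ^+ 2]mulr1 -[X in _ + _ + _ * X + _]dC.
by rewrite /mink /det3 /wedge23; ring.
Qed.

(** The Gram matrix is [M J M^T] with [M] the matrix of rows [A], [B], [C] and [det J = -1]. *)
Lemma gram_det3 A B C : deSitter A -> deSitter B -> deSitter C ->
  1 + 2 * mink B C * mink A C * mink A B
  - mink B C ^+ 2 - mink A C ^+ 2 - mink A B ^+ 2 = - det3 A B C ^+ 2.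
Proof.
rewrite /deSitter => dA dB dC.
transitivity (mink A A * mink B B * mink C C
  + 2 * mink B C * mink A C * mink A B - mink A A * mink B C ^+ 2
  - mink B B * mink A C ^+ 2 - mink C C * mink A B ^+ 2).
  by rewrite dA dB dC; ring.
by rewrite /mink /det3 /wedge23; ring.
Qed.

Lemma det3_neq0 A B C : free [:: A; B; C] -> wedge23 B C != 0 ->
  det3 A B C != 0.
Proof.
move=> freeABC /eqP w_neq0; apply/eqP=> det0; apply: w_neq0.
have /freeP fr : free [tuple A; B; C] by [].
pose k (i : 'I_3) := [:: wedge23 B C; wedge23 C A; wedge23 A B]`_i.
apply: (fr k _ ord0).
rewrite !big_ord_recl big_ord0 addr0 /k /= addrA.
by apply/rowP=> i; rewrite wedge23_relation det0 mxE; case: eqP.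
Qed.

(** * Signs of the minors against cosines and contractibility *)

Lemma middle_mink_gt0 A B C :
  deSitter A -> deSitter B -> deSitter C ->
  -1 <= mink A C -> -1 < mink B C < 1 ->
  wedge23 B C * wedge23 C A < 0 -> wedge23 C A * wedge23 A B < 0 ->
  0 < mink A B + mink B C.
Proof.
move=> dA dB dC hy hx ab bc; rewrite ltNge; apply/negP => s_le0.
have b_neq0 : wedge23 C A != 0.
  by apply: contraTneq ab => ->; rewrite mulr0 ltxx.
(* Flipping [B] negates its two cosines and its coefficient; an overall sign change, harmless as the
   form is even, moves the minus signs to the other two coefficients. *)
have := @cone_form_gt0 R (mink A C) (- mink B C) (- mink A B)
  (wedge23 C A) (- wedge23 B C) (- wedge23 A B) hy ltac:(lra) ltac:(lra) b_neq0
  ltac:(lra) ltac:(lra).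
have := wedge23_form A B C dA dB dC; have := sqr_ge0 (det3 A B C); lra.
Qed.

Lemma same_sign_mink_lt0 A B C :
  deSitter A -> deSitter B -> deSitter C ->
  -1 <= mink B C -> -1 < mink A C < 1 ->
  0 < wedge23 B C * wedge23 C A -> 0 < wedge23 B C * wedge23 A B ->
  mink A B + mink A C < 0.
Proof.
move=> dA dB dC hx hy ab ac; rewrite ltNge; apply/negP => s_ge0.
have a_neq0 : wedge23 B C != 0.
  by apply: contraTneq ab => ->; rewrite mul0r ltxx.
have := @cone_form_gt0 R (mink B C) (mink A C) (mink A B)
  (wedge23 B C) (wedge23 C A) (wedge23 A B) hx ltac:(lra) ltac:(lra) a_neq0
  ltac:(lra) ltac:(lra).
have := wedge23_form A B C dA dB dC; have := sqr_ge0 (det3 A B C); lra.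
Qed.

Lemma middle_contractible A B C :
  wedge23 B C * wedge23 C A < 0 -> wedge23 C A * wedge23 A B < 0 ->
  contractible A B C.
Proof.
move=> ab bc.
have b_neq0 : wedge23 C A != 0.
  by apply: contraTneq ab => ->; rewrite mulr0 ltxx.
have b2_gt0 : 0 < wedge23 C A ^+ 2 by rewrite exprn_even_gt0.
(* Normal to the line through the projections of [A] and [C]. *)
pose n : 'rV[R]_2 := \row_(j < 2)
  (wedge23 C A * if j == 0 then A 0 2 - C 0 2 else C 0 1 - A 0 1).
have nE x : dot n (proj23 x) = wedge23 C A *
    ((A 0 2 - C 0 2) * x 0 1 + (C 0 1 - A 0 1) * x 0 2).
  by rewrite dot_proj23 !mxE /=; ring.
have nA : dot n (proj23 A) = wedge23 C A ^+ 2 by rewrite nE /wedge23; ring.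
have nC : dot n (proj23 C) = wedge23 C A ^+ 2 by rewrite nE /wedge23; ring.
have nB : dot n (proj23 B) =
    - (wedge23 B C * wedge23 C A) - wedge23 C A * wedge23 A B.
  by rewrite nE /wedge23; ring.
exists n; last by rewrite nA nB nC b2_gt0; split => //; lra.
apply: contraTneq b2_gt0 => n0; rewrite -nA n0 dot_proj23 !mxE.
by rewrite !mul0r addr0 ltxx.
Qed.

Lemma contractible_rot A B C : contractible B C A -> contractible A B C.
Proof. by case=> n n0 [nB nC nA]; exists n. Qed.

(** Pairing [n] with the planar relation among the projections would make a sum of positive terms
    vanish. *)
Lemma same_sign_not_contractible A B C :
  0 < wedge23 B C * wedge23 C A -> 0 < wedge23 B C * wedge23 A B ->
  ~ contractible A B C.
Proof.
move=> ab ac [n _ [nA nB nC]].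
have a2_gt0 : 0 < wedge23 B C ^+ 2.
  by rewrite exprn_even_gt0//=; apply: contraTneq ab => ->; rewrite mul0r ltxx.
have : wedge23 B C * (wedge23 B C * dot n (proj23 A) +
    wedge23 C A * dot n (proj23 B) + wedge23 A B * dot n (proj23 C)) = 0.
  by rewrite !dot_proj23 /wedge23; ring.
have := mulr_gt0 a2_gt0 nA; have := mulr_gt0 ab nB; have := mulr_gt0 ac nC; lra.
Qed.

(** Either all signs agree or one of [v], [w], [u] is the odd one out; the cyclic form matches the
    rotations of the triangle. *)
Lemma sign_cases (u v w : R) : u != 0 -> v != 0 -> w != 0 ->
  [\/ 0 < u * v /\ 0 < u * w, u * v < 0 /\ v * w < 0,
      v * w < 0 /\ w * u < 0 | w * u < 0 /\ u * v < 0].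
Proof.
move=> u0 v0 w0.
have uv : u * v != 0 by rewrite mulf_neq0.
have uw : u * w != 0 by rewrite mulf_neq0.
have u2 : 0 < u ^+ 2 by rewrite exprn_even_gt0.
have e : u ^+ 2 * (v * w) = (u * v) * (u * w) by ring.
case/orP: (lt_total uv) => huv; case/orP: (lt_total uw) => huw.
- by constructor 4; rewrite mulrC.
- by constructor 2; split=> //; rewrite -(pmulr_rlt0 _ u2) e nmulr_rlt0.
- constructor 3; split; last by rewrite mulrC.
  by rewrite -(pmulr_rlt0 _ u2) e pmulr_rlt0.
- by constructor 1.
Qed.

End Triangle.

Theorem theorem5p15 (R : realType) (A B C : 'rV[R]_3) (a b c : R)
  (triangleABC : spatiolateral_triangle A B C)
  (nondegABC : nondegenerate_triangle A B C)
  (def_a : a = side_length B C)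
  (def_b : b = side_length A C)
  (def_c : c = side_length A B) :
  (~ contractible A B C -> 2 * pi < a + b + c) /\
  (contractible A B C -> a + b + c < 2 * pi).
Proof.
case: triangleABC => -[dA dB dC] [_ [sAB sBC sAC]].
have hz := spacelike_side_mink A B dA dB sAB.
have hx := spacelike_side_mink B C dB dC sBC.
have hy := spacelike_side_mink A C dA dC sAC.
have wd (t : R) : -1 < t < 1 -> -1 <= t <= 1 by move=> ?; lra.
have lt_pi (t : R) : -1 < t < 1 -> acos t < pi.
  by move=> ?; apply: acos_ltpi; lra.
have w1 := wedge23_neq0 B C dB dC hx.
have w2 : wedge23 C A != 0 by apply: wedge23_neq0 => //; rewrite minkC.
have w3 := wedge23_neq0 A B dA dB hz.
rewrite def_a def_b def_c /side_length.
have pa := lt_pi _ hx; have pb := lt_pi _ hy; have pc := lt_pi _ hz.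
have [[h1 h2]|[h1 h2]|[h1 h2]|[h1 h2]] := sign_cases _ _ _ w1 w2 w3.
- split=> [_|/(same_sign_not_contractible A B C h1 h2)//].
  have bc_gt0 : 0 < wedge23 C A * wedge23 A B.
    have a2_gt0 : 0 < wedge23 B C ^+ 2 by rewrite exprn_even_gt0.
    rewrite -(pmulr_rgt0 _ a2_gt0).
    have -> : wedge23 B C ^+ 2 * (wedge23 C A * wedge23 A B) =
      (wedge23 B C * wedge23 C A) * (wedge23 B C * wedge23 A B) by ring.
    exact: mulr_gt0.
  apply: acos3_gt_2pi => //.
  + have := same_sign_mink_lt0 C A B dC dA dB; rewrite (minkC C A) (minkC C B).
    rewrite addrC; apply; rewrite ?(mulrC (wedge23 A B))//; lra.
  + have := same_sign_mink_lt0 A B C dA dB dC; rewrite addrC; apply => //; lra.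
  + have := same_sign_mink_lt0 B C A dB dC dA; rewrite (minkC C A) (minkC B A).
    apply => //; rewrite ?(mulrC _ (wedge23 B C))//; lra.
  + by rewrite gram_det3// oppr_lt0 exprn_even_gt0//=; apply: det3_neq0.
- have hc := middle_contractible A B C h1 h2; split=> // _.
  have s := middle_mink_gt0 A B C dA dB dC ltac:(lra) hx h1 h2.
  (* The two sides at [B] total less than [pi], and the third is itself less than [pi]. *)
  have := acosD_lt_pi _ _ (wd _ hz) (wd _ hx) s; lra.
- have hc := contractible_rot A B C (middle_contractible B C A h1 h2).
  split=> // _.
  have := middle_mink_gt0 B C A dB dC dA; rewrite (minkC C A) (minkC B A).
  move=> /(_ ltac:(lra) hy h1 h2) s.
  have := acosD_lt_pi _ _ (wd _ hx) (wd _ hy) s; lra.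
- have hc := contractible_rot A B C (contractible_rot B C A
    (middle_contractible C A B h1 h2)).
  split=> // _.
  have := middle_mink_gt0 C A B dC dA dB; rewrite (minkC C A) (minkC C B).
  move=> /(_ ltac:(lra) hz h1 h2) s.
  have := acosD_lt_pi _ _ (wd _ hy) (wd _ hz) s; lra.
Qed.
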